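(* Let $(a_n)_{n\ge 1}$ be a sequence of positive integers with partial sums $S_n=\sum_{i=1}^n a_i$, and suppose there is an integer $k>1$ such that $S_{2n}=k\,S_n$ for every $n\ge 1$. Assume that there exists a real polynomial $p(x)$ such that $a_n=p(n)$ for all $n\ge 1$. Then there exist a constant $C\neq 0$ and an integer $d\ge 1$ such that, for all $n\ge 1$, $$a_n=C\left(n^d-(n-1)^d\right),\qquad S_n=C\,n^d,$$ and in particular $k=2^d$.
   Context: The relation $S_{2n}=k\,S_n$ for all $n\ge 1$ is called the Galileo relation, and a sequence of positive integers satisfying it for some integer $k>1$ is called a Galileo sequence. The constant $C$ is a real number. *)

(* Defs.v *)
From mathcomp Require Import all_boot all_order all_algebra reals.

Set Implicit Arguments.
Unset Strict Implicit.
Unset Printing Implicit Defensive.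

Local Open Scope nat_scope.

(* A sequence (a_n)_{n >= 1} is a function on nat; its value at 0 is junk and
   is never used. *)
Definition partial_sum (a : nat -> nat) (n : nat) : nat :=
  \sum_(1 <= i < n.+1) a i.

Definition galileo_relation (k : nat) (S : nat -> nat) : Prop :=
  forall n : nat, 1 <= n -> S (2 * n) = k * S n.

(* Main.v *)
Require Import Defs.
From mathcomp Require Import all_boot all_order all_algebra reals.
From mathcomp Require Import ring.

Import Order.TTheory GRing.Theory Num.Theory.
Local Open Scope ring_scope.

(** The partial sums of a polynomial sequence are the values of a polynomial q.
    The Galileo relation holds at infinitely many points, so q(2x) = k q(x) as
    polynomials; comparing coefficients, 2^i = k whenever q_i <> 0, so q is a
    monomial. *)

Lemma coef_addX1_exp (R : comNzRingType) (n i : nat) :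
  (('X + 1 : {poly R}) ^+ n)`_i = 'C(n, i)%:R.
Proof.
rewrite addrC exprDn coef_sum.
under eq_bigr do rewrite expr1n mul1r coefMn coefXn.
have [lt_i|lt_i] := ltnP i n.+1.
  rewrite (bigD1 (Ordinal lt_i)) //= eqxx big1 ?addr0 // => j ne_j.
  by case: eqP => [eq_ij|_]; rewrite ?mul0rn //; case/eqP: ne_j; apply: val_inj.
rewrite bin_small // big1 // => j _.
by rewrite gtn_eqF ?mul0rn // (leq_trans (ltn_ord j)).
Qed.

(** Induction on a bound for the size of [p]: the forward difference of ['X^(m.+1)] has degree [m],
    so a multiple of it removes the top coefficient of [p], and its sums telescope. *)
Lemma poly_antidifference (F : numFieldType) (p : {poly F}) :
  exists q : {poly F}, forall n : nat, q.[n%:R] = \sum_(i < n) p.[i%:R].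
Proof.
have [m] := ubnP (size p); elim: m p => // -[|m] IHm p; rewrite ltnS => le_p.
  exists 0 => n; move: le_p; rewrite leqn0 size_poly_eq0 => /eqP->.
  by rewrite big1 ?horner0 // => i _; rewrite horner0.
pose c := p`_m / m.+1%:R.
have [|q q_sum] := IHm (p - c *: (('X + 1) ^+ m.+1 - 'X^(m.+1))).
  rewrite ltnS; apply/leq_sizeP => j le_mj.
  rewrite coefB coefZ coefB coef_addX1_exp coefXn.
  have [->|ne_jm] := eqVneq j m.
    by rewrite ltn_eqF // subr0 binSn divfK ?subrr // pnatr_eq0.
  have lt_mj : (m < j)%N by rewrite ltn_neqAle eq_sym ne_jm.
  rewrite (leq_sizeP _ _ le_p) // sub0r.
  have [->|ne_jm1] := eqVneq j m.+1; first by rewrite binn subrr mulr0 oppr0.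
  by rewrite bin_small ?subrr ?mulr0 ?oppr0 // ltn_neqAle eq_sym ne_jm1.
exists (q + c *: 'X^(m.+1)) => n; rewrite !hornerE q_sum.
elim: n => [|n IHn]; first by rewrite !big_ord0 expr0n mulr0 addr0.
by rewrite !big_ord_recr /= -IHn !hornerE /= -natr1; ring.
Qed.

(** Otherwise [p - q] would be nonzero with as many distinct roots [1, 2, ...] as its size, which
    exceeds its degree. *)
Lemma poly_eq_on_pos_nat (R : numDomainType) (p q : {poly R}) :
  (forall n : nat, (1 <= n)%N -> p.[n%:R] = q.[n%:R]) -> p = q.
Proof.
move=> eq_pq; apply/eqP; rewrite -subr_eq0; apply/negPn/negP => nz.
pose s := [seq i%:R : R | i <- iota 1 (size (p - q))].
have: (size s < size (p - q)%R)%N.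
  apply: max_poly_roots => //.
    apply/allP => _ /mapP[i i_in ->]; move: i_in; rewrite mem_iota => /andP[i_gt0 _].
    by rewrite rootE hornerD hornerN eq_pq ?subrr.
  by rewrite map_inj_uniq ?iota_uniq // => i j /eqP; rewrite eqr_nat => /eqP.
by rewrite size_map size_iota ltnn.
Qed.

Lemma dilation_eigenpoly (R : numDomainType) (k : nat) (q : {poly R}) :
    q != 0 -> (forall n : nat, (1 <= n)%N -> q.[(2 * n)%:R] = k%:R * q.[n%:R]) ->
  exists d : nat, k = (2 ^ d)%N /\ q = lead_coef q *: 'X^d.
Proof.
move=> nz_q q_dil.
have coef_q i : q`_i * 2 ^+ i = k%:R * q`_i.
  (* The left side is the coefficient of [q(2x)], to be compared with that of [k q(x)]. *)
  have <- : (q \Po (2 *: 'X))`_i = q`_i * 2 ^+ i.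
    rewrite comp_polyE coef_sum.
    under eq_bigr do rewrite exprZn !coefZ coefXn.
    have [lt_i|le_i] := ltnP i (size q).
      rewrite (bigD1 (Ordinal lt_i)) //= eqxx mulr1 big1 ?addr0 // => j ne_j.
      case: eqP => [eq_ij|_]; last by rewrite !mulr0.
      by case/eqP: ne_j; apply: val_inj.
    rewrite [q`_i]nth_default // mul0r big1 // => j _.
    by rewrite gtn_eqF ?mulr0 // (leq_trans (ltn_ord j)).
  rewrite -coefZ; congr (polyseq _)`_i; apply: poly_eq_on_pos_nat => n n_gt0.
  by rewrite horner_comp !hornerE -q_dil // natrM.
have pow_k i : q`_i != 0 -> k = (2 ^ i)%N.
  move=> nz_i; apply/eqP; rewrite -(eqr_nat R) natrX.
  by apply/eqP/(mulIf nz_i); rewrite -coef_q mulrC.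
have nz_lead : q`_(size q).-1 != 0 by rewrite -[_`__]/(lead_coef q) lead_coef_eq0.
exists (size q).-1; split; first exact: pow_k.
apply/polyP => i; rewrite coefZ coefXn.
have [->|ne_id] := eqVneq i (size q).-1; first by rewrite mulr1.
(* A second nonzero coefficient would give [k] as two different powers of 2. *)
rewrite mulr0; apply/eqP/(contraNT _ ne_id) => /pow_k k_i.
by rewrite -(eqn_exp2l _ _ (ltnSn 1)) -k_i (pow_k _ nz_lead).
Qed.

Theorem theorem3 (R : realType) (a : nat -> nat) (k : nat)
    (a_pos : forall n : nat, (1 <= n)%N -> (0 < a n)%N)
    (k_gt1 : (1 < k)%N)
    (a_galileo : galileo_relation k (partial_sum a))
    (a_poly : exists p : {poly R},
        forall n : nat, (1 <= n)%N -> (a n)%:R = p.[n%:R]) :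
  exists (C : R) (d : nat),
    [/\ C != 0,
        (1 <= d)%N,
        forall n : nat, (1 <= n)%N ->
          (a n)%:R = C * (n%:R ^+ d - (n%:R - 1) ^+ d)
          /\ (partial_sum a n)%:R = C * n%:R ^+ d
      & k = (2 ^ d)%N].
Proof.
have [p a_p] := a_poly.
(* The shift by 1 reconciles sums over [i < n] with partial sums starting at index 1. *)
have [q q_sum] := poly_antidifference _ (p \Po ('X + 1)).
have S_q n : (partial_sum a n)%:R = q.[n%:R].
  rewrite q_sum /partial_sum big_add1 big_mkord natr_sum.
  by apply: eq_bigr => i _; rewrite a_p // horner_comp !hornerE natr1.
have a1 : partial_sum a 1 = a 1%N by rewrite /partial_sum big_nat1.
(* The value of [q] at 1 is the positive term [a 1]. *)
have nz_q : q != 0.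
  apply: contraTneq (a_pos 1%N isT) => q0.
  by rewrite -a1 -(ltr_nat R) S_q q0 horner0 ltxx.
have [|d [k_d q_d]] := dilation_eigenpoly _ k _ nz_q.
  by move=> n n_gt0; rewrite -!S_q a_galileo // natrM.
have S_d n : (partial_sum a n)%:R = lead_coef q * n%:R ^+ d.
  by rewrite S_q [in LHS]q_d !hornerE.
(* The exponent 0 would give [k = 1]. *)
have d_gt0 : (0 < d)%N by case: d k_d {q_d S_d} k_gt1 => // ->.
exists (lead_coef q), d; split=> //; first by rewrite lead_coef_eq0.
(* The term at [n.+1] is a difference of consecutive partial sums; [S_d] also holds at 0, so the
   first term needs no separate case. *)
case=> // n _; split=> //.
rewrite mulrBr -S_d -natr1 addrK -S_d /partial_sum.
by rewrite [in X in X - _]big_nat_recr //= natrD addrC addKr.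
Qed.
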